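(* Let $V_\epsilon(x)=V_0(x)+V_1(x,x/\epsilon)$, $\epsilon>0$, be a multiscale potential on $\mathbb{R}^n$ as in the context, and assume that $V_1$ has bounded oscillation uniformly in $\epsilon$, i.e. $\operatorname{osc}V_1=\sup_x V_1(x,x/\epsilon)-\inf_x V_1(x,x/\epsilon)$ is bounded by a finite constant independent of $\epsilon$. Suppose the sampling strategy uses a proposal kernel $q(x\to y)$ that does not depend on $\epsilon$, with either the Metropolis or the Barker acceptance rule. Then for any $f:\mathbb{R}^n\to\mathbb{R}$, $$e^{-2\operatorname{osc}V_1}\,\mathbb{E}_{\mu_0}\big[|f(X_{k+1})-f(X_k)|^2\big]\le \mathbb{E}_{\mu}\big[|f(X_{k+1})-f(X_k)|^2\big]\le e^{2\operatorname{osc}V_1}\,\mathbb{E}_{\mu_0}\big[|f(X_{k+1})-f(X_k)|^2\big].$$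
   Context: Potentials. $V_0:\mathbb{R}^n\to\mathbb{R}$ is smooth, bounded below, trapping ($V_0(x)\to\infty$ as $|x|\to\infty$), with $e^{-V_0}$ integrable; $V_1(x,y)$ is smooth and bounded. The inverse temperature is $\beta=1$. Put $\mu(dx)=Z^{-1}e^{-V_\epsilon(x)}dx$ and $\mu_0(dx)=Z_0^{-1}e^{-V_0(x)}dx$, with $Z,Z_0$ the normalizing constants ($\mu$ depends on $\epsilon$). Sampler. For a target density proportional to $e^{-V}$ and a proposal kernel with (positive) density $q(x\to y)$, set $R(x,y)=V(x)-V(y)+\log\frac{q(y\to x)}{q(x\to y)}$. Given $X_k$, a proposal $X^{\mathrm p}_{k+1}\sim q(X_k\to\cdot)$ is drawn; with probability $F(R(X_k,X^{\mathrm p}_{k+1}))$ one sets $X_{k+1}=X^{\mathrm p}_{k+1}$, otherwise $X_{k+1}=X_k$. Here $F$ is either the Metropolis rule $F(r)=\min(1,e^{r})$ or the Barker rule $F(r)=(1+e^{-r})^{-1}$ (the same choice throughout). Notation. $\mathbb{E}_\mu[|f(X_{k+1})-f(X_k)|^2]$ is the expectation for one step of the chain with target $\mu$ (i.e. $V=V_\epsilon$) started from $X_k\sim\mu$; $\mathbb{E}_{\mu_0}[|f(X_{k+1})-f(X_k)|^2]$ is the expectation for one step of the chain with target $\mu_0$ (i.e. $V=V_0$), with the same proposal kernel $q$ and the same $F$, started from $X_k\sim\mu_0$. Functions $f$ are measurable. *)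

(* Defs.v *)
From HB Require Import structures.
From mathcomp Require Import all_boot all_order all_algebra.
From mathcomp Require Import all_classical all_reals all_analysis.
From mathcomp Require Import measurable_realfun.

Set Implicit Arguments.
Unset Strict Implicit.
Unset Printing Implicit Defensive.

Import Order.TTheory GRing.Theory Num.Theory.
Import numFieldNormedType.Exports.

Local Open Scope classical_set_scope.
Local Open Scope ring_scope.

(* R^n is 'rV[R]_n.  Its sigma-algebra is the product one (as the library does
   for n.-tuple R); [measurable_rVE] below identifies it with the Borel one. *)

Definition rV_display : measure_display -> measure_display.
Proof. exact. Qed.

Section rV_measurable.
Context (R : realType) (n : nat).

Definition rV_coord (i : 'I_n) (x : 'rV[R]_n) : R := x ord0 i.

HB.instance Definition _ :=
  @isMeasurable.Build (rV_display default_measure_display)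
    'rV[R]_n (g_sigma_preimage rV_coord) (@sigma_algebra0 _ _ _)
    (@sigma_algebraC _ _) (@sigma_algebra_bigcup _ _ _).

Lemma measurable_rV_coord (i : 'I_n) : measurable_fun [set: 'rV[R]_n] (rV_coord i).
Proof.
move=> _ Y mY; rewrite setTI; apply: sub_sigma_algebra => /=.
rewrite -bigcup_seq/=; exists i => /=; first by rewrite mem_index_enum.
by exists Y => //; rewrite setTI.
Qed.

Lemma measurable_fun_rV d (T : measurableType d) (f : T -> 'rV[R]_n) :
  (forall i, measurable_fun [set: T] (fun t => f t ord0 i)) ->
  measurable_fun [set: T] f.
Proof.
move=> mf _ A mA.
suff : measurable `<=` [set B : set 'rV[R]_n | measurable (f @^-1` B)].
  by move=> /(_ A mA) /=; rewrite setTI.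
apply: smallest_sub => //=.
  split => /=.
  - by rewrite preimage_set0.
  - by move=> B mB; rewrite setTD preimage_setC; exact: measurableC.
  - by move=> F mF; rewrite preimage_bigcup; exact: bigcup_measurable.
rewrite -bigcup_seq => B [i _ [C mC <-]] /=.
by rewrite setTI -[X in measurable X]setTI; exact: mf.
Qed.

End rV_measurable.

Section borel.
Context (R : realType) (n : nat).

Lemma measurable_rV_ball (c : 'rV[R]_n) (e : R) : measurable (ball c e).
Proof.
have [e0|e0] := ltP 0 e; last first.
  rewrite (_ : ball c e = set0)//; apply/seteqP; split => // x [].
  by move=> /(le_lt_trans e0); rewrite ltxx.
have -> : ball c e = \bigcap_(i in [set: 'I_n]) (@rV_coord R n i @^-1` ball (c ord0 i) e).
  apply/seteqP; split => x /=; first by move=> [_ h] i _; exact: h.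
  by move=> h; split => // i j; rewrite ord1; exact: h.
apply: fin_bigcap_measurable => // i _.
rewrite -[X in measurable X]setTI.
by apply: measurable_rV_coord => //; exact: measurable_ball.
Qed.

Lemma open_rV_measurable (U : set 'rV[R]_n) : open U -> measurable U.
Proof.
move=> oU.
pose B (i : 'rV[rat]_n * nat) : set 'rV[R]_n :=
  @ball R 'rV[R]_n (map_mx (@ratr R) i.1) (i.2.+1%:R^-1).
have -> : U = \bigcup_i (if `[< B i `<=` U >] then B i else set0).
  apply/seteqP; split => x; last first.
    by move=> [i _]; case: asboolP => // BU; exact: BU.
  move=> Ux; have /nbhs_ballP[e /= e0 eU] := open_nbhs_nbhs (conj oU Ux).
  have [k ke] : exists k, k.+1%:R^-1 < e / 2.
    have e20 : 0 < e / 2 by rewrite divr_gt0.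
    by have [k _ /(_ k (leqnn k))] := near_infty_natSinv_lt (PosNum e20); exists k.
  pose r : R := k.+1%:R^-1; have r0 : 0 < r by rewrite invr_gt0.
  have /choice[c Hc] i : exists c : rat, ball (ratr c : R) r (x ord0 i).
    have : x ord0 i - r < x ord0 i by rewrite ltrBlDr ltrDl.
    move=> /rat_in_itvoo[c]; rewrite in_itv/= => /andP[h1 h2]; exists c.
    by rewrite /ball /= distrC ger0_norm ?subr_ge0 ?(ltW h2)// ltrBlDr addrC -ltrBlDr.
  have xB : B (\row_i c i, k) x.
    by split => // i j; rewrite !mxE ord1.
  exists (\row_i c i, k) => //.
  case: asboolP => // -[] y yB; apply: eU.
  have -> : e = e / 2 + e / 2 by rewrite -splitr.
  apply: (@ball_triangle R 'rV[R]_n (map_mx (@ratr R) (\row_i c i))).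
    by apply: ball_sym; apply: le_ball xB; exact: ltW.
  by apply: le_ball yB; exact: ltW.
apply: countable_bigcupT_measurable => // i.
by case: asboolP => // _; exact: measurable_rV_ball.
Qed.

Lemma measurable_rVE :
  (@measurable _ 'rV[R]_n : set (set 'rV[R]_n)) = <<s open >>.
Proof.
apply/seteqP; split; last first.
  by apply: smallest_sub; [exact: sigma_algebra_measurable|exact: open_rV_measurable].
apply: smallest_sub; first exact: smallest_sigma_algebra.
rewrite -bigcup_seq => A [i _ [C mC <-]]; rewrite setTI.
suff : (@measurable _ R) `<=` [set C | <<s open >> (rV_coord i @^-1` C)] by exact.
rewrite [X in X `<=` _]RGenOpens.measurableE.
apply: smallest_sub.
  split => /=.
  - by rewrite preimage_set0; exact: sigma_algebra0.
  - by move=> B mB; rewrite setTD preimage_setC; exact: sigma_algebraC.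
  - by move=> F mF; rewrite preimage_bigcup; exact: sigma_algebra_bigcup.
move=> _ [x [y ->]]; apply: sub_sigma_algebra.
by apply: open_comp => // z _; exact: coord_continuous.
Qed.

Lemma continuous_rV_measurable (f : 'rV[R]_n -> R) :
  continuous f -> measurable_fun [set: 'rV[R]_n] f.
Proof.
move=> cf; apply: (measurability _ (RGenOpens.measurableE R)) => _ [_ [x [y ->]] <-].
rewrite setTI; apply: open_rV_measurable; by apply: open_comp => //.
Qed.

End borel.

(* [pushforward], carrying the measurability proof so that the measure structure
   is inferred. *)
Section image_measure.
Context d1 d2 (T1 : measurableType d1) (T2 : measurableType d2) (R : realType).
Variables (m : {measure set T1 -> \bar R}) (f : T1 -> T2).
Hypothesis mf : measurable_fun [set: T1] f.

Definition image_measure of measurable_fun [set: T1] f : set T2 -> \bar R :=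
  pushforward m f.

Local Notation nu := (image_measure mf).

Let nu0 : nu set0 = 0%E.
Proof. by rewrite /image_measure /pushforward preimage_set0 measure0. Qed.

Let nu_ge0 A : (0 <= nu A)%E.
Proof. exact: measure_ge0. Qed.

Let nu_sigma_additive : semi_sigma_additive nu.
Proof.
move=> F mF tF mUF; rewrite /image_measure /pushforward preimage_bigcup.
apply: measure_semi_sigma_additive.
- by move=> k; rewrite -[X in measurable X]setTI; exact: mf.
- apply/trivIsetP => /= i j _ _ ij; rewrite -preimage_setI.
  by move/trivIsetP : tF => /(_ _ _ _ _ ij) ->//; rewrite preimage_set0.
- by rewrite -preimage_bigcup -[X in measurable X]setTI; exact: mf.
Qed.

HB.instance Definition _ :=
  isMeasure.Build _ _ _ nu nu0 nu_ge0 nu_sigma_additive.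

End image_measure.

(* The Lebesgue measure on R^n, by recursion: 'rV_0 has one point, and the
   measure on 'rV_(1 + n) is the image of the product measure on R * 'rV_n. *)

Section lebesgue_rV.
Context (R : realType).

Definition rV_cons n (p : measurableTypeR R * 'rV[R]_n) : 'rV[R]_n.+1 :=
  row_mx (\row_(i < 1) (p.1 : R)) p.2 : 'rV[R]_(1 + n).

Definition rV_uncons n (x : 'rV[R]_n.+1) : measurableTypeR R * 'rV[R]_n :=
  (x ord0 ord0, @rsubmx _ 1 1 n x).

Lemma rV_consK n : cancel (@rV_cons n) (@rV_uncons n).
Proof.
move=> [a x]; rewrite /rV_cons /rV_uncons row_mxKr; congr pair.
rewrite (_ : @ord0 n = @lshift 1 n ord0); last exact/val_inj.
by apply: etrans (row_mxEl _ _ _ _) _; rewrite mxE.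
Qed.

Lemma rV_consE0 n p : @rV_cons n p ord0 ord0 = p.1.
Proof. by rewrite -{2}(rV_consK p). Qed.

Lemma rV_consE1 n (p : measurableTypeR R * 'rV[R]_n) i :
  rV_cons p ord0 (lift ord0 i) = p.2 ord0 i.
Proof.
rewrite (_ : lift ord0 i = @rshift 1 n i); last exact/val_inj.
exact: row_mxEr.
Qed.

Lemma measurable_rV_cons n : measurable_fun setT (@rV_cons n).
Proof.
apply: measurable_fun_rV => i.
case: (splitP (i : 'I_(1 + n))) => j ij.
  rewrite (_ : (fun _ => _) = fst)//.
  apply/funext => p; rewrite /= (_ : i = lshift n j); last exact/val_inj.
  by apply: etrans (row_mxEl _ _ _ _) _; rewrite mxE.
rewrite (_ : (fun _ => _) = @rV_coord R n j \o snd).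
  by apply: measurableT_comp => //; exact: measurable_rV_coord.
apply/funext => p; rewrite /= (_ : i = rshift 1 j); last exact/val_inj.
exact: row_mxEr.
Qed.

Lemma measurable_rV_uncons n : measurable_fun setT (@rV_uncons n).
Proof.
apply/measurable_fun_pair => /=; first exact: (measurable_rV_coord ord0).
apply: measurable_fun_rV => i.
rewrite (_ : (fun _ => _) = @rV_coord R n.+1 (rshift 1 i)).
  exact: measurable_rV_coord.
by apply/funext => x; rewrite mxE.
Qed.

Section step.
Context (n : nat) (m : {sigma_finite_measure set 'rV[R]_n -> \bar R}).

Definition lebesgue_rV_step : set 'rV[R]_n.+1 -> \bar R :=
  image_measure (lebesgue_measure \x m)%E (@measurable_rV_cons n).

HB.instance Definition _ := Measure.on lebesgue_rV_step.

Let sigma_finite_step : sigma_finite setT lebesgue_rV_step.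
Proof.
have /sigma_finiteP[F [TF ndF Foo]] := sigma_finiteT (@lebesgue_measure R).
have /sigma_finiteP[G [TG ndG Goo]] := sigma_finiteT m.
exists (fun k => @rV_uncons n @^-1` (F k `*` G k)).
  rewrite -preimage_bigcup (_ : \bigcup_k _ = setT) ?preimage_setT//.
  rewrite -setXTT TF TG predeqE => -[x y]; split.
    by move=> [k _ []/= ? ?]; split; exists k.
  move=> [/= [k _ Fkx] [l _ Gly]]; exists (maxn k l) => //; split.
  - by move: x Fkx; exact/subsetPset/ndF/leq_maxl.
  - by move: y Gly; exact/subsetPset/ndG/leq_maxr.
move=> k; have [mF Fk] := Foo k; have [mG Gk] := Goo k; split.
  rewrite -[X in measurable X]setTI.
  by apply: measurable_rV_uncons => //; exact: measurableX.
rewrite /lebesgue_rV_step /image_measure /pushforward -comp_preimage.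
rewrite (_ : _ \o _ = id); last by apply/funext => p; exact: rV_consK.
by rewrite preimage_id /= product_measure1E// lte_mul_pinfty// ge0_fin_numE.
Qed.

HB.instance Definition _ :=
  @Measure_isSigmaFinite.Build _ _ _ lebesgue_rV_step sigma_finite_step.

End step.

Fixpoint lebesgue_rV n : {sigma_finite_measure set 'rV[R]_n -> \bar R} :=
  match n with
  | 0 => @dirac _ 'rV[R]_0 0 R
  | k.+1 => lebesgue_rV_step (lebesgue_rV k)
  end.

End lebesgue_rV.

Section box.
Context (R : realType).
Local Open Scope ereal_scope.

Lemma measurable_rV_box n (a b : 'I_n -> R) :
  measurable [set x : 'rV[R]_n | forall i, x ord0 i \in `]a i, b i]].
Proof.
rewrite (_ : mkset _ = \bigcap_(i in [set: 'I_n])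
    (@rV_coord R n i @^-1` [set` `]a i, b i]])); last first.
  by apply/seteqP; split => x /=; [move=> h i _|move=> h i]; exact: h.
apply: fin_bigcap_measurable => // i _.
rewrite -[X in measurable X]setTI.
exact: measurable_rV_coord.
Qed.

Lemma lebesgue_rV_box n (a b : 'I_n -> R) :
  lebesgue_rV R n [set x : 'rV[R]_n | forall i, x ord0 i \in `]a i, b i]] =
  \prod_(i < n) (lebesgue_measure (`]a i, b i]%classic : set R)).
Proof.
elim: n => [|n IH] in a b *.
  rewrite big_ord0 /= diracE mem_set//= => -[m mn].
  by exfalso; move: mn; rewrite ltn0.
rewrite big_ord_recl -(IH (a \o lift ord0) (b \o lift ord0)).
rewrite -product_measure1E//=; last exact: measurable_rV_box.
rewrite /lebesgue_rV_step /image_measure /pushforward; congr (_ _).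
apply/seteqP; split => -[x y] /=.
- move=> h; split.
    by have := h ord0; rewrite rV_consE0.
  by move=> i; have := h (lift ord0 i); rewrite rV_consE1.
- move=> [h0 h] i; have [j ->|->] := unliftP ord0 i; last by rewrite rV_consE0.
  by rewrite rV_consE1; exact: h.
Qed.

End box.

Section smooth.
Context (R : realType) (U : normedModType R).

Fixpoint Ck (k : nat) (f : U -> R) : Prop :=
  match k with
  | 0 => continuous f
  | j.+1 => (forall x, differentiable f x) /\ forall v, Ck j ('D_v f)
  end.

Definition smooth (f : U -> R) := forall k, Ck k f.

End smooth.

Section potentials.
Context (R : realType) (n : nat).

(* `|x| is the sup norm of 'rV[R]_n, equivalent to the Euclidean one. *)
Definition trapping (V0 : 'rV[R]_n -> R) :=
  forall M : R, exists r : R, forall x, r <= `|x| -> M <= V0 x.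

Definition confining_potential (V0 : 'rV[R]_n -> R) :=
  [/\ smooth V0, exists m, forall x, m <= V0 x, trapping V0 &
      (lebesgue_rV R n).-integrable [set: 'rV[R]_n] (fun x => (expR (- V0 x))%:E)].

Definition smooth_bounded (V1 : 'rV[R]_n -> 'rV[R]_n -> R) :=
  smooth (fun p : 'rV[R]_n * 'rV[R]_n => V1 p.1 p.2) /\
  exists M, forall x y, `|V1 x y| <= M.

Definition perturbation (V1 : 'rV[R]_n -> 'rV[R]_n -> R) (eps : R)
    (x : 'rV[R]_n) : R :=
  V1 x (eps^-1 *: x).

Definition multiscale (V0 : 'rV[R]_n -> R)
    (V1 : 'rV[R]_n -> 'rV[R]_n -> R) (eps : R) (x : 'rV[R]_n) : R :=
  V0 x + perturbation V1 eps x.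

End potentials.

Definition osc (R : realType) (T : Type) (g : T -> R) : R :=
  sup (range g) - inf (range g).

(* The measure with density f with respect to mu; it is the zero measure when f
   is not measurable and nonnegative, so that it is a measure for every f. *)
Section density.
Context d (T : measurableType d) (R : realType).
Variables (mu : {measure set T -> \bar R}) (f : T -> R).

Definition density_ok := measurable_fun [set: T] f /\ forall x, 0 <= f x.

Definition density (A : set T) : \bar R :=
  \int[mu]_(x in A) (if `[< density_ok >] then f x else 0)%:E.

Let density0 : density set0 = 0%E.
Proof. by rewrite /density integral_set0. Qed.

Let density_ge0 A : (0 <= density A)%E.
Proof.
apply: integral_ge0 => x _; rewrite lee_fin.
by case: asboolP => // -[_]; exact.
Qed.

Let density_sigma_additive : semi_sigma_additive density.
Proof.
apply: semi_sigma_additive_nng_induced => [|x]; last first.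
  by rewrite lee_fin; case: asboolP => // -[_]; exact.
by case: asboolP => [[mf _]|_]; [exact/measurable_EFinP|exact: measurable_cst].
Qed.

HB.instance Definition _ :=
  isMeasure.Build _ _ _ density density0 density_ge0 density_sigma_additive.

End density.

Variant acceptance_rule := Metropolis | Barker.

Definition acceptance (R : realType) (F : acceptance_rule) (r : R) : R :=
  match F with
  | Metropolis => Num.min 1 (expR r)
  | Barker => (1 + expR (- r))^-1
  end.

Section sampler.
Context (R : realType) (n : nat).
Variables (V : 'rV[R]_n -> R) (q : 'rV[R]_n -> 'rV[R]_n -> R).
Variable F : acceptance_rule.

Definition gibbs : set 'rV[R]_n -> \bar R :=
  density (lebesgue_rV R n)
    (fun x => expR (- V x) / fine (\int[lebesgue_rV R n]_y (expR (- V y))%:E)).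

HB.instance Definition _ := Measure.on gibbs.

Definition log_ratio x y : R := V x - V y + ln (q y x / q x y).

Definition accept x y : R := acceptance F (log_ratio x y).

Definition proposal x : set 'rV[R]_n -> \bar R := density (lebesgue_rV R n) (q x).

HB.instance Definition _ x := Measure.on (proposal x).

(* Law of X_(k+1) given X_k = x: proposals y stay at y with probability
   accept x y, and the rejected ones are sent to x. *)
Definition transition x : set 'rV[R]_n -> \bar R :=
  measure_add
    (density (proposal x) (accept x))
    (image_measure (density (proposal x) (fun y => 1 - accept x y))
       (@measurable_cst _ _ _ _ setT x)).

HB.instance Definition _ x := Measure.on (transition x).

(* Expectation of g X_k X_(k+1) when X_k has law [gibbs]. *)
Definition one_step_expectation (g : 'rV[R]_n -> 'rV[R]_n -> R) : \bar R :=
  \int[gibbs]_x \int[transition x]_y (g x y)%:E.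

End sampler.

Definition proposal_density (R : realType) (n : nat)
    (q : 'rV[R]_n -> 'rV[R]_n -> R) :=
  [/\ measurable_fun [set: 'rV[R]_n * 'rV[R]_n] (fun p => q p.1 p.2),
      forall x y, 0 < q x y &
      forall x, (\int[lebesgue_rV R n]_y (q x y)%:E)%E = 1%E].

Section mass.
Context (R : realType) (n : nat).
Implicit Types (V : 'rV[R]_n -> R) (q : 'rV[R]_n -> 'rV[R]_n -> R).
Local Open Scope ereal_scope.

Lemma densityE d (T : measurableType d) (mu : {measure set T -> \bar R})
  (f : T -> R) A : measurable_fun [set: T] f -> (forall x, 0 <= f x)%R ->
  density mu f A = \int[mu]_(x in A) (f x)%:E.
Proof. by move=> mf f0; rewrite /density; case: asboolP => // -[]. Qed.

Lemma gibbs_setT V : measurable_fun [set: 'rV[R]_n] V ->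
  (lebesgue_rV R n).-integrable [set: 'rV[R]_n] (fun x => (expR (- V x))%:E) ->
  gibbs V [set: 'rV[R]_n] = 1.
Proof.
move=> mV iV; set Z := \int[lebesgue_rV R n]_y (expR (- V y))%:E.
have mexp : measurable_fun [set: 'rV[R]_n] (fun x => expR (- V x))%R.
  by apply: measurableT_comp => //; exact: measurableT_comp.
have Z0 : 0 <= Z by apply: integral_ge0 => x _; rewrite lee_fin expR_ge0.
have Zfin : Z \is a fin_num by exact: integrable_fin_num.
have Zn0 : Z != 0.
  apply/eqP => Z00.
  have : \int[lebesgue_rV R n]_y `|(expR (- V y))%:E| = 0.
    by rewrite -[RHS]Z00; apply: eq_integral => x _; rewrite gee0_abs// lee_fin expR_ge0.
  move=> /(ae_eq_integral_abs _ measurableT).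
  move=> /(_ (measurable_int _ iV)) [N [mN N0 sub]].
  have NT : N = setT.
    apply/seteqP; split => // x _; apply: sub => /= /(_ Logic.I) [] /eqP.
    by rewrite gt_eqF// expR_gt0.
  have := lebesgue_rV_box (fun _ : 'I_n => 0%R : R) (fun _ => 1%R).
  rewrite [RHS]big1; last by move=> i _; rewrite lebesgue_measure_itv/= lte01 oppr0 adde0.
  move=> box.
  have : lebesgue_rV R n [set x : 'rV[R]_n |
      forall i, x ord0 i \in `]0%R, 1%R]] <= lebesgue_rV R n N
    by apply: le_measure; rewrite ?inE//; [exact: measurable_rV_box|rewrite NT].
  by rewrite box N0 leNgt lte01.
rewrite /gibbs densityE//; last 2 first.
- exact: measurable_funM.
- by move=> x; rewrite divr_ge0 ?expR_ge0// fine_ge0.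
under eq_integral do rewrite EFinM.
rewrite ge0_integralZr//=; last 2 first.
- exact/measurable_EFinP.
- by rewrite lee_fin invr_ge0 fine_ge0.
by rewrite -/Z -{1}(fineK Zfin) -EFinM divff// fine_eq0.
Qed.

Lemma acceptance_itv F (r : R) : (0 <= acceptance F r <= 1)%R.
Proof.
case: F => /=.
  by rewrite le_min ler01 expR_ge0 ge_min lexx.
by rewrite invr_ge0 addr_ge0 ?expR_ge0//= invf_le1 ?ler_wpDr ?expR_ge0//.
Qed.

Lemma measurable_accept V q F x : measurable_fun [set: 'rV[R]_n] V ->
  proposal_density q -> measurable_fun [set: 'rV[R]_n] (accept V q F x).
Proof.
move=> mV [mq q0 _].
have mqx : measurable_fun [set: 'rV[R]_n] (q x).
  by have := measurableT_comp mq (measurable_pair1 x).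
have mqx' : measurable_fun [set: 'rV[R]_n] (q ^~ x).
  by have := measurableT_comp mq (measurable_pair2 x).
have mr : measurable_fun [set: 'rV[R]_n] (log_ratio V q x).
  apply: measurable_funD; first exact: measurable_funB.
  apply: measurableT_comp => //; apply: measurable_funM => //.
  rewrite (_ : (fun y => _) = (fun y => expR (- ln (q x y))))%R.
    apply: measurableT_comp => //; apply: measurableT_comp => //.
    exact: measurableT_comp.
  by apply/funext => y; rewrite expRN lnK// posrE.
rewrite /accept; case: F => /=.
  apply: measurable_minr => //; exact: measurableT_comp.
rewrite (_ : (fun y => _) = (fun y => expR (- ln (1 + expR (- log_ratio V q x y)))))%R.
  apply: measurableT_comp => //; apply: measurableT_comp => //.
  apply: measurableT_comp => //; apply: measurable_funD => //.
  by apply: measurableT_comp => //; exact: measurableT_comp.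
by apply/funext => y; rewrite (expRN (ln _)) lnK// posrE ltr_pwDl// expR_ge0.
Qed.

Lemma transition_setT V q F x : measurable_fun [set: 'rV[R]_n] V ->
  proposal_density q -> transition V q F x [set: 'rV[R]_n] = 1.
Proof.
move=> mV qd; have ma := measurable_accept F x mV qd.
have a01 y : (0 <= accept V q F x y <= 1)%R by exact: acceptance_itv.
rewrite /transition measure_addE/= /image_measure /pushforward preimage_setT.
rewrite !densityE//.
- rewrite -ge0_integralD//=.
  + under eq_integral do rewrite -EFinD addrC subrK.
    rewrite integral_cst// mul1e /proposal.
    have [mq q0 q1] := qd.
    have mqx : measurable_fun [set: 'rV[R]_n] (q x).
      by have := measurableT_comp mq (measurable_pair1 x).
    by apply: etrans (densityE _ _ mqx _) (q1 x) => y; exact/ltW.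
  + by move=> y _; rewrite lee_fin; have /andP[] := a01 y.
  + exact/measurable_EFinP.
  + by move=> y _; rewrite lee_fin subr_ge0; have /andP[] := a01 y.
  + by apply/measurable_EFinP; exact: measurable_funB.
- exact: measurable_funB.
- by move=> y; rewrite subr_ge0; have /andP[] := a01 y.
- by move=> y; have /andP[] := a01 y.
Qed.

End mass.

(* Main.v *)
Require Import Defs.
From mathcomp Require Import all_boot all_order all_algebra.
From mathcomp Require Import all_classical all_reals all_analysis.
From mathcomp Require Import measurable_realfun lra.

Import Order.TTheory GRing.Theory Num.Theory.
Import numFieldNormedType.Exports.

Local Open Scope classical_set_scope.
Local Open Scope ring_scope.

(** The rejected proposals contribute nothing to E|f(X_(k+1)) - f(X_k)|^2, so it
    is the double integral of |f y - f x|^2 against q(x, y) with the weight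
    exp(-V x) / Z * F(R(x, y)).  If V - W oscillates by at most c, passing from W
    to V changes the normalized density exp(-V x) / Z by a factor at most e^c,
    and it changes R(x, y) by at most c; as F(r + c) <= e^c F(r), the acceptance
    probability also changes by a factor at most e^c.  The theorem is this
    comparison applied to the pair V_eps, V_0 in both orders. *)

Section integral_comparison.
Context d (T : measurableType d) (R : realType).
Local Open Scope ereal_scope.
Import HBNNSimple.

(* No measurability is needed, because the integral of a nonnegative function is
   defined as a supremum over the simple functions below it. *)
Lemma ge0_le_integral_scale (m1 m2 : {measure set T -> \bar R}) (a b : R)
    (f1 f2 : T -> \bar R) :
  (0 <= a)%R -> (0 < b)%R ->
  (forall S, measurable S -> m1 S <= a%:E * m2 S) ->
  (forall x, 0 <= f1 x) -> (forall x, 0 <= f2 x) ->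
  (forall x, f1 x <= b%:E * f2 x) ->
  \int[m1]_x f1 x <= (a * b)%:E * \int[m2]_x f2 x.
Proof.
move=> a0 b0 m12 f10 f20 f12; rewrite !ge0_integralTE//.
apply: ge_ereal_sup => _ [h/= hf1 <-].
have bi0 : (0 <= b^-1)%R by rewrite invr_ge0 ltW.
(* If the simple function [h] lies below [f1], then [h / b] lies below [f2], so it competes in the
   supremum defining the integral of [f2]. *)
pose k := scale_nnsfun h bi0.
have kf2 x : (k x)%:E <= f2 x.
  rewrite -(@lee_pmul2l _ b%:E) ?lte_fin// -EFinM /= mulrA divff ?gt_eqF//.
  by rewrite mul1r (le_trans (hf1 x)).
apply: (@le_trans _ _ (a%:E * sintegral m2 h)).
  rewrite !sintegralE ge0_mule_fsumr; last exact: nnsfun_mulemu_ge0.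
  rewrite lee_fsum// => r [t _ <-].
  by rewrite muleCA lee_wpmul2l ?lee_fin ?m12.
have -> : sintegral m2 h = b%:E * sintegral m2 k.
  by rewrite (sintegralrM m2 b^-1 h) muleA -EFinM divff ?gt_eqF// mul1e.
rewrite muleA -EFinM lee_wpmul2l ?lee_fin ?mulr_ge0 ?(ltW b0)//.
by apply: ereal_sup_ubound; exists k.
Qed.

Lemma density_scale_le (mu : {measure set T -> \bar R}) (h1 h2 : T -> R) (c : R) :
  measurable_fun setT h1 -> measurable_fun setT h2 ->
  (forall x, 0 <= h1 x)%R -> (forall x, 0 <= h2 x)%R -> (0 <= c)%R ->
  (forall x, h1 x <= c * h2 x)%R ->
  forall A, measurable A -> density mu h1 A <= c%:E * density mu h2 A.
Proof.
move=> mh1 mh2 h10 h20 c0 h12 A mA; rewrite !densityE//.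
rewrite -ge0_integralZl//=; last 2 first.
- by apply/measurable_EFinP; exact: measurable_funTS.
- by move=> x _; rewrite lee_fin.
apply: ge0_le_integral => //=.
- by move=> x _; rewrite lee_fin.
- by apply/measurable_EFinP; exact: measurable_funTS.
- by apply/measurable_EFinP; apply: measurable_funM => //; exact: measurable_funTS.
- by move=> x _; rewrite lee_fin.
Qed.

End integral_comparison.

(** For Metropolis, the factor moves inside the minimum, giving min(e^c, e^(c+s)), and both entries
    dominate min(1, e^r). For Barker, clearing denominators leaves 1 + e^(-s) <= e^c + e^(c-r),
    which holds term by term. *)
Lemma acceptance_scale_le (R : realType) F (c r s : R) :
  0 <= c -> r - s <= c -> acceptance F r <= expR c * acceptance F s.
Proof.
move=> c0 rsc; have c1 : 1 <= expR c by rewrite -expR0 ler_expR.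
case: F => /=.
  rewrite minr_pMr ?expR_ge0// mulr1 -expRD le_min !ge_min c1/= ler_expR.
  by rewrite (_ : r <= c + s) ?orbT//; lra.
rewrite ler_pdivlMr ?addr_gt0 ?expR_gt0//.
rewrite mulrC ler_pdivrMr ?addr_gt0 ?expR_gt0//.
by rewrite mulrDr mulr1 -expRD lerD// ler_expR; lra.
Qed.

Section osc_theory.
Context (R : realType) (T : Type) (g : T -> R) (M : R).
Hypothesis gM : forall x, `|g x| <= M.

(** The bound [M] makes [sup] and [inf] of the range true bounds; on an unbounded set they could be
    default values. *)
Lemma sub_le_osc x y : g x - g y <= osc g.
Proof.
rewrite /osc lerB//.
- apply: sup_ubound; last by exists x.
  by exists M => _ [z _ <-]; exact: le_trans (ler_norm _) (gM z).
- apply: inf_lbound; last by exists y.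
  exists (- M) => _ [z _ <-]; rewrite lerNl.
  by rewrite (le_trans _ (gM z))// -normrN ler_norm.
Qed.

End osc_theory.

Section sampler_comparison.
Context (R : realType) (n : nat).
Implicit Types (V W : 'rV[R]_n -> R).
Let leb := lebesgue_rV R n.

Lemma measurable_expRN V : measurable_fun setT V ->
  measurable_fun setT (fun x => expR (- V x)).
Proof. by move=> mV; apply: measurableT_comp => //; exact: measurableT_comp. Qed.

Lemma integrable_expRN_sub V W (c : R) :
  measurable_fun setT V ->
  leb.-integrable setT (fun x => (expR (- W x))%:E) ->
  (forall x y, (V x - W x) - (V y - W y) <= c) ->
  leb.-integrable setT (fun x => (expR (- V x))%:E).
Proof.
move=> mV iW VW; pose k := expR (c - (V 0 - W 0)).
have := integrableZl measurableT k iW.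
apply: le_integrable => //.
  by apply/measurable_EFinP; exact: measurable_expRN.
move=> x _ /=; rewrite lee_fin !ger0_norm ?mulr_ge0 ?expR_ge0//.
rewrite -expRD ler_expR; have := VW 0 x; lra.
Qed.

Lemma partition_function_ge0 V : 0 <= fine (\int[leb]_y (expR (- V y))%:E).
Proof. by rewrite fine_ge0// integral_ge0// => y _; rewrite lee_fin expR_ge0. Qed.

Lemma partition_function_le V W (s : R) :
  measurable_fun setT V -> measurable_fun setT W ->
  leb.-integrable setT (fun x => (expR (- V x))%:E) ->
  leb.-integrable setT (fun x => (expR (- W x))%:E) ->
  (forall x, W x <= V x + s) ->
  fine (\int[leb]_y (expR (- V y))%:E) <=
  expR s * fine (\int[leb]_y (expR (- W y))%:E).
Proof.
move=> mV mW iV iW WV.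
rewrite -lee_fin EFinM !fineK; [|exact: integrable_fin_num..].
rewrite -ge0_integralZl//; last first.
  by apply/measurable_EFinP; exact: measurable_expRN.
apply: ge0_le_integral => // [||x _].
- by apply/measurable_EFinP; exact: measurable_expRN.
- apply/measurable_EFinP; apply: measurable_funM => //.
  exact: measurable_expRN.
- by rewrite lee_fin -expRD ler_expR; have := WV x; lra.
Qed.

(** Put d = V - W. The ratio of the densities at x is exp(-d x) Z_W / Z_V, and d <= c + d x
    everywhere gives Z_W / Z_V <= exp(c + d x). Anchoring both factors at the same x cancels d x, so
    e^c is paid once, not twice. *)
Lemma gibbs_density_scale_le V W (c : R) :
  measurable_fun setT V -> measurable_fun setT W ->
  leb.-integrable setT (fun x => (expR (- V x))%:E) ->
  leb.-integrable setT (fun x => (expR (- W x))%:E) ->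
  (forall x y, (V x - W x) - (V y - W y) <= c) ->
  forall x, expR (- V x) / fine (\int[leb]_y (expR (- V y))%:E) <=
    expR c * (expR (- W x) / fine (\int[leb]_y (expR (- W y))%:E)).
Proof.
move=> mV mW iV iW VW x.
have ZWV : fine (\int[leb]_y (expR (- W y))%:E) <=
    expR (c + V x - W x) * fine (\int[leb]_y (expR (- V y))%:E).
  apply: partition_function_le => // y; have := VW y x; lra.
(* This converse bound serves to deduce [0 < ZW] from [0 < ZV]. *)
have ZVW : fine (\int[leb]_y (expR (- V y))%:E) <=
    expR (c - (V x - W x)) * fine (\int[leb]_y (expR (- W y))%:E).
  apply: partition_function_le => // y; have := VW x y; lra.
move: (partition_function_ge0 V) (partition_function_ge0 W) ZWV ZVW.
set ZV := fine (\int[leb]_y (expR (- V y))%:E).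
set ZW := fine (\int[leb]_y (expR (- W y))%:E) => ZV0 ZW0 ZWV ZVW.
(* Division by zero returns 0, so for [ZV = 0] the left side vanishes. *)
have [->|ZVn0] := eqVneq ZV 0.
  by rewrite invr0 mulr0 !mulr_ge0 ?expR_ge0 ?invr_ge0.
have ZVp : 0 < ZV by rewrite lt_neqAle eq_sym ZVn0.
have ZWp : 0 < ZW.
  by rewrite -(pmulr_rgt0 _ (expR_gt0 (c - (V x - W x)))) (lt_le_trans ZVp).
rewrite mulrA ler_pdivrMr// mulrAC ler_pdivlMr//.
rewrite (le_trans (ler_wpM2l (expR_ge0 _) ZWV))//.
by rewrite !mulrA -!expRD (_ : - V x + (c + V x - W x) = c - W x)//; lra.
Qed.

Variables (q : 'rV[R]_n -> 'rV[R]_n -> R) (F : acceptance_rule).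
Hypothesis hq : proposal_density q.
Variable g : 'rV[R]_n -> 'rV[R]_n -> R.
Hypotheses (mg : forall x, measurable_fun setT (g x))
  (g0 : forall x y, 0 <= g x y) (gxx : forall x, g x x = 0).

Lemma integral_transition V x : measurable_fun setT V ->
  (\int[transition V q F x]_y (g x y)%:E =
   \int[density (proposal q x) (accept V q F x)]_y (g x y)%:E)%E.
Proof.
move=> mV.
have mgE : measurable_fun setT (EFin \o g x) by exact/measurable_EFinP.
rewrite /transition ge0_integral_measure_add//=; last first.
  by move=> y _; rewrite lee_fin.
(* The rejection part is an image under the constant map to x, so its integral sees only [g x x]. *)
rewrite [X in (_ + X)%E](_ : _ = 0%E) ?adde0//.
rewrite /image_measure.
rewrite (@ge0_integral_pushforward _ _ _ _ _ (cst x))//; last first.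
  by move=> y _; rewrite lee_fin.
by apply: integral0_eq => y _ /=; rewrite gxx.
Qed.

Lemma one_step_expectation_scale_le V W (c : R) :
  measurable_fun setT V -> measurable_fun setT W ->
  leb.-integrable setT (fun x => (expR (- V x))%:E) ->
  leb.-integrable setT (fun x => (expR (- W x))%:E) ->
  (forall x y, (V x - W x) - (V y - W y) <= c) ->
  (one_step_expectation V q F g <=
   (expR (2 * c))%:E * one_step_expectation W q F g)%E.
Proof.
move=> mV mW iV iW VW.
have c0 : 0 <= c by rewrite (le_trans _ (VW 0 0))// subrr.
have a0 U x y : 0 <= accept U q F x y by have /andP[] := acceptance_itv F (log_ratio U q x y).
have mgibbs (U : 'rV[R]_n -> R) : measurable_fun setT U -> measurable_fun setT
    (fun x => expR (- U x) / fine (\int[leb]_y (expR (- U y))%:E)).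
  by move=> mU; apply: measurable_funM => //; exact: measurable_expRN.
have gibbs0 (U : 'rV[R]_n -> R) x : 0 <= expR (- U x) / fine (\int[leb]_y (expR (- U y))%:E).
  by rewrite divr_ge0 ?expR_ge0// partition_function_ge0.
(* One factor e^c pays for the change of the initial law, the other bounds the inner integrals
   pointwise. *)
rewrite mulr_natl mulr2n expRD /one_step_expectation.
apply: ge0_le_integral_scale; rewrite ?expR_ge0 ?expR_gt0//.
- by apply: density_scale_le => //; [exact: mgibbs|exact: mgibbs|exact: gibbs_density_scale_le].
- by move=> x; apply: integral_ge0 => y _; rewrite lee_fin.
- by move=> x; apply: integral_ge0 => y _; rewrite lee_fin.
(* Here the integrand is common to both sides, so all of e^c goes to the measure. *)
move=> x; rewrite !integral_transition// -[expR c]mulr1.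
apply: ge0_le_integral_scale; rewrite ?expR_ge0//.
- apply: density_scale_le; rewrite ?expR_ge0//; try exact: measurable_accept.
  (* Both samplers share [q], so the logarithmic terms cancel and only the potentials remain. *)
  move=> y; apply: acceptance_scale_le => //; rewrite /log_ratio.
  by have := VW x y; lra.
- by move=> y; rewrite lee_fin.
- by move=> y; rewrite lee_fin.
- by move=> y; rewrite mul1e.
Qed.

End sampler_comparison.

Lemma continuous_perturbation (R : realType) (n : nat)
    (V1 : 'rV[R]_n -> 'rV[R]_n -> R) (eps : R) :
  smooth_bounded V1 -> continuous (perturbation V1 eps).
Proof.
move=> [sV1 _] x.
apply: (@continuous_comp _ _ _ (fun y : 'rV[R]_n => (y, eps^-1 *: y))
  (fun p => V1 p.1 p.2)); last exact: (sV1 0%N).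
have idx : y @[y --> x] --> x by exact: cvg_id.
exact: (cvg_pair idx (@scaler_continuous _ _ _ x)).
Qed.

Theorem theorem2p1 (R : realType) (n : nat)
    (V0 : 'rV[R]_n -> R) (V1 : 'rV[R]_n -> 'rV[R]_n -> R)
    (hV0 : confining_potential V0) (hV1 : smooth_bounded V1)
    (hosc : exists C : R, forall eps : R, 0 < eps -> osc (perturbation V1 eps) <= C)
    (q : 'rV[R]_n -> 'rV[R]_n -> R) (hq : proposal_density q)
    (F : acceptance_rule) (eps : R) (heps : 0 < eps)
    (f : 'rV[R]_n -> R) (hf : measurable_fun [set: 'rV[R]_n] f) :
  let E V := one_step_expectation V q F (fun x y => `|f y - f x| ^+ 2) in
  let c := osc (perturbation V1 eps) in
  ((expR (- (2 * c)))%:E * E V0 <= E (multiscale V0 V1 eps))%E /\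
  (E (multiscale V0 V1 eps) <= (expR (2 * c))%:E * E V0)%E.
Proof.
move=> E c.
have [sV0 _ _ iV0] := hV0.
have mV0 : measurable_fun setT V0 by apply: continuous_rV_measurable; exact: (sV0 0%N).
have mV : measurable_fun setT (multiscale V0 V1 eps).
  apply: measurable_funD => //; apply: continuous_rV_measurable.
  exact: continuous_perturbation.
have [M V1M] := hV1.2.
have w_osc x y : perturbation V1 eps x - perturbation V1 eps y <= c.
  by apply: (@sub_le_osc _ _ _ M) => z; exact: V1M.
have VV0 x y : (multiscale V0 V1 eps x - V0 x) - (multiscale V0 V1 eps y - V0 y) <= c.
  by have := w_osc x y; rewrite /multiscale; lra.
have V0V x y : (V0 x - multiscale V0 V1 eps x) - (V0 y - multiscale V0 V1 eps y) <= c.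
  by have := w_osc y x; rewrite /multiscale; lra.
have iV := integrable_expRN_sub _ _ _ _ _ mV iV0 VV0.
have mg x : measurable_fun setT (fun y => `|f y - f x| ^+ 2).
  by apply: measurable_funX; apply: measurableT_comp => //; exact: measurable_funB.
have g0 x y : 0 <= `|f y - f x| ^+ 2 by [].
have gxx x : `|f x - f x| ^+ 2 = 0 by rewrite subrr normr0 expr0n.
split; last exact: one_step_expectation_scale_le.
(* Moving the exponential across turns the lower bound into the upper bound with the two potentials
   exchanged. *)
rewrite expRN lee_pdivrMl ?expR_gt0//.
exact: one_step_expectation_scale_le.
Qed.
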